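(* For every real $c<2$, there is no deterministic online algorithm that is $c$-competitive for the unidirectional transaction stream problem with rejection (defined in the context).
   Context: Unidirectional transaction stream with rejection. A payment channel $(\ell,r)$; user $\ell$ has balance $b$, initially $0$. A sequence $X_t=(x_1,\dots,x_t)$ of transactions of sizes $x_i\in\mathbb{R}^+$, all in the left-to-right direction, arrives one by one. Each transaction must be accepted or rejected by $\ell$, in order of arrival. Accepting $x$ requires $b\ge x$ and decreases $b$ by $x$ at no cost; rejecting $x$ costs $Rx+f_2$. At any time $\ell$ may recharge the channel on-chain, adding an amount $F$ of funds to $b$, at cost $F+f_1$. Here $R,f_1,f_2\in\mathbb{R}^+$ are constants. The cost of an algorithm is the sum of its rejection and recharging costs. A deterministic online algorithm ON makes its decisions knowing only the transactions that have arrived so far. OFF is an optimal offline algorithm, knowing the whole sequence in advance. ON is $c$-competitive if $\mathrm{Cost}_{\mathrm{ON}}(X_t)\le c\cdot\mathrm{Cost}_{\mathrm{OFF}}(X_t)$ for every transaction sequence $X_t$. *)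

(* Defs.v *)
From mathcomp Require Import all_boot all_order all_algebra.
From mathcomp Require Import classical_sets reals.

Set Implicit Arguments.
Unset Strict Implicit.
Unset Printing Implicit Defensive.

Import Order.TTheory GRing.Theory Num.Theory.
Local Open Scope classical_set_scope.
Local Open Scope ring_scope.

Inductive action (R : Type) : Type :=
  | Recharge of R
  | Accept
  | Reject.
Arguments Accept {R}.
Arguments Reject {R}.

Definition transactions (R : realType) (X : seq R) : bool :=
  all (fun x => 0 < x) X.

(* [feasible b X s]: starting from balance [b], the actions [s] are legal and
   decide every transaction of [X], in order. [Accept] and [Reject] consume the
   next undecided transaction; [Recharge] may occur at any position. *)
Fixpoint feasible (R : realType) (b : R) (X : seq R) (s : seq (action R)) :
    bool :=
  match s, X with
  | [::], [::] => true
  | Recharge F :: s', _ => (0 <= F) && feasible (b + F) X s'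
  | Accept :: s', x :: X' => (x <= b) && feasible (b - x) X' s'
  | Reject :: s', _ :: X' => feasible b X' s'
  | _, _ => false
  end.

(* [r] is the proportional rejection cost. The value is meaningful only when
   [s] is feasible for [X]. *)
Fixpoint cost (R : realType) (r f1 f2 : R) (X : seq R) (s : seq (action R)) :
    R :=
  match s, X with
  | Recharge F :: s', _ => F + f1 + cost r f1 f2 X s'
  | Accept :: s', _ :: X' => cost r f1 f2 X' s'
  | Reject :: s', x :: X' => r * x + f2 + cost r f1 f2 X' s'
  | _, _ => 0
  end.

(* The infimum is a minimum: among the schedules accepting a given set of
   transactions, the cheapest one recharges at most once, at the start, by the
   total accepted size, and there are finitely many such sets. *)
Definition off_cost (R : realType) (r f1 f2 : R) (X : seq R) : R :=
  inf [set cost r f1 f2 X s | s in [set s | feasible 0 X s]].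

(* [on h] lists the actions performed once exactly the transactions [h] have
   arrived and before the next arrival; [on [::]] precedes all arrivals. *)
Definition run (R : realType) (on : seq R -> seq (action R)) (X : seq R) :
    seq (action R) :=
  flatten [seq on (take i X) | i <- iota 0 (size X).+1].

(* As this ranges over all sequences, prefixes included, each nonempty history
   is answered by exactly one decision, concerning the latest arrival. *)
Definition online_algorithm (R : realType) (on : seq R -> seq (action R)) :
    Prop :=
  forall X : seq R, transactions X -> feasible 0 X (run on X).

Definition competitive (R : realType) (r f1 f2 c : R)
    (on : seq R -> seq (action R)) : Prop :=
  forall X : seq R, transactions X -> X != [::] ->
    cost r f1 f2 X (run on X) <= c * off_cost r f1 f2 X.

(* Main.v *)
Require Import Defs.
From mathcomp Require Import all_boot all_order all_algebra.
From mathcomp Require Import classical_sets reals.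
From mathcomp Require Import ring lra.

Import Order.TTheory GRing.Theory Num.Theory.
Local Open Scope ring_scope.

(** Feed the algorithm equal transactions of a tiny size [e]. As every rejection
costs at least [f2], far more than [e], almost all transactions must be
accepted, so the funds [B] recharged so far essentially dominate the total size
[A] that has arrived, while the offline cost is at most [f1 + A]. When the
[k+1]-st recharge occurs, bringing the funds to [B'], competitiveness therefore
gives [(k + 1) f1 + B' <= (2 - eta) (f1 + B)] for some [eta > 0]. Inductively,
[B <= f1 (k - eta k (k + 1) / 2)] after [k] recharges. Since [B >= 0], this bounds
[k], hence [B], hence [A], although the stream can be made arbitrarily long. *)

(** * Statistics of schedules and offline cost on constant streams *)

Section Schedules.
Set Implicit Arguments.
Unset Strict Implicit.
Variable R : realType.
Implicit Types (s : seq (action R)) (X : seq R).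

Definition recharges s : seq R :=
  pmap (fun a => if a is Recharge F then Some F else None) s.

Definition rejections s : nat := count (fun a => if a is Reject then true else false) s.

Definition funds s : R := \sum_(F <- recharges s) F.

Lemma funds_cat s1 s2 : funds (s1 ++ s2) = funds s1 + funds s2.
Proof. by rewrite /funds /recharges pmap_cat big_cat. Qed.

Lemma funds_no_recharge s : size (recharges s) = 0%N -> funds s = 0.
Proof. by move/size0nil; rewrite /funds => ->; rewrite big_nil. Qed.

Lemma feasible_recharges_ge0 b X s :
  feasible b X s -> all (fun F => 0 <= F) (recharges s).
Proof.
elim: s b X => [|[F||] s IH] b X //=.
- by case/andP=> -> /IH.
- by case: X => // x X /andP[_ /IH].
- by case: X => // x X /IH.
Qed.

Lemma funds_ge0 s : all (fun F => 0 <= F) (recharges s) -> 0 <= funds s.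
Proof.
by move=> /allP s_ge0; rewrite /funds big_seq; apply: sumr_ge0 => F /s_ge0.
Qed.

(** Accepted transactions are paid out of the initial balance and the recharges; all others are
    rejected. *)
Lemma feasible_size_le (e b : R) n s :
  0 <= b -> 0 <= e -> feasible b (nseq n e) s ->
  n%:R * e <= b + funds s + (rejections s)%:R * e.
Proof.
move=> + e_ge0; rewrite /funds /rejections.
elim: s b n => [|[F||] s IH] b [|n] //= b_ge0.
- by rewrite big_nil !mul0r !addr0.
- by move=> /andP[F_ge0 /(IH _ 0%N)]; rewrite big_cons add0n; lra.
- by move=> /andP[F_ge0 /(IH _ n.+1)]; rewrite big_cons add0n; lra.
- by move=> /andP[e_le /IH]; rewrite add0n -natr1; lra.
- by move=> /(IH _ _ b_ge0); rewrite natrD -natr1; lra.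
Qed.

Lemma cost_nseq (r f1 f2 e b : R) n s :
  feasible b (nseq n e) s ->
  cost r f1 f2 (nseq n e) s =
  (size (recharges s))%:R * f1 + funds s + (rejections s)%:R * (r * e + f2).
Proof.
rewrite /funds /rejections.
elim: s b n => [|[F||] s IH] b [|n] //=.
- by rewrite big_nil !mul0r !addr0.
- by move=> /andP[_ /(IH _ 0%N) /= ->]; rewrite big_cons add0n -natr1; ring.
- by move=> /andP[_ /(IH _ n.+1) /= ->]; rewrite big_cons add0n -natr1; ring.
- by move=> /andP[_ /IH ->].
- by move=> /IH ->; rewrite natrD; ring.
Qed.

Lemma cost_ge0 (r f1 f2 b : R) X s :
  0 <= r -> 0 <= f1 -> 0 <= f2 -> transactions X -> feasible b X s ->
  0 <= cost r f1 f2 X s.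
Proof.
move=> r_ge0 f1_ge0 f2_ge0.
elim: s b X => [|[F||] s IH] b X //=.
- by move=> X_gt0 /andP[F_ge0 /(IH _ _ X_gt0)]; lra.
- by case: X => // x X /andP[_ X_gt0] /andP[_ /(IH _ _ X_gt0)].
- case: X => // x X /andP[x_gt0 X_gt0] /(IH _ _ X_gt0).
  by have := mulr_ge0 r_ge0 (ltW x_gt0); lra.
Qed.

Lemma feasible_nseq_Accept (e b : R) n :
  0 <= e -> n%:R * e <= b -> feasible b (nseq n e) (nseq n Accept).
Proof.
move=> e_ge0; elim: n b => [|n IH] b //=; rewrite -natr1 => le_b.
have := mulr_ge0 (ler0n R n) e_ge0 => ne_ge0.
by apply/andP; split; [|apply: IH]; lra.
Qed.

Lemma cost_nseq_Accept (r f1 f2 e : R) n :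
  cost r f1 f2 (nseq n e) (nseq n Accept) = 0.
Proof. by elim: n. Qed.

Lemma off_cost_ge0 (r f1 f2 : R) X :
  0 <= r -> 0 <= f1 -> 0 <= f2 -> transactions X -> 0 <= off_cost r f1 f2 X.
Proof.
move=> r_ge0 f1_ge0 f2_ge0 X_gt0; apply: lb_le_inf; last first.
  by move=> _ [s s_feas <-]; apply: cost_ge0 s_feas.
exists (cost r f1 f2 X (nseq (size X) Reject)), (nseq (size X) Reject) => //=.
by elim: X {X_gt0} => //.
Qed.

(** The witness recharges once, by the total size, and then accepts everything. *)
Lemma off_cost_nseq_le (r f1 f2 e : R) n :
  0 <= r -> 0 <= f1 -> 0 <= f2 -> 0 < e ->
  off_cost r f1 f2 (nseq n e) <= f1 + n%:R * e.
Proof.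
move=> r_ge0 f1_ge0 f2_ge0 e_gt0.
have ne_ge0 : 0 <= n%:R * e by rewrite mulr_ge0 ?ler0n ?ltW.
apply: ge_inf; last first.
  exists (Recharge (n%:R * e) :: nseq n Accept) => /=.
    by rewrite ne_ge0 add0r; apply: feasible_nseq_Accept (ltW e_gt0) _.
  by rewrite cost_nseq_Accept; ring.
exists 0 => _ [s s_feas <-]; apply: cost_ge0 s_feas => //.
by rewrite /transactions all_nseq e_gt0 orbT.
Qed.

Lemma run_nseqS (on : seq R -> seq (action R)) (e : R) n :
  run on (nseq n.+1 e) = run on (nseq n e) ++ on (nseq n.+1 e).
Proof.
have iotaE : iota 0 n.+2 = iota 0 n.+1 ++ [:: n.+1] by rewrite -(addn1 n.+1) iotaD.
rewrite /run !size_nseq iotaE map_cat flatten_cat.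
congr (flatten _ ++ _); last by rewrite [LHS]cats0 take_oversize ?size_nseq.
apply/eq_in_map => i; rewrite mem_iota ltnS => /andP[_ le_in].
by rewrite !take_nseq // (leq_trans le_in).
Qed.

End Schedules.

(** * Growth of the funds with the number of recharges *)

Section RechargeBound.
Set Implicit Arguments.
Unset Strict Implicit.
Variables (R : realType) (f1 eta : R).
Hypotheses (f1_gt0 : 0 < f1) (eta_gt0 : 0 < eta).

Definition funds_bounded (k : nat) (B : R) : Prop :=
  B <= f1 * (k%:R - eta * (k%:R * (k%:R + 1)) / 2).

Lemma funds_bounded_next k B B' :
  0 <= B -> funds_bounded k B ->
  k.+1%:R * f1 + B' <= (2 - eta) * (f1 + B) ->
  funds_bounded k.+1 B'.
Proof.
rewrite /funds_bounded -(natr1 k) => B_ge0 le_B le_B'.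
(* Inserting the bound on [B] into [2 * B] and discarding [eta * B] leaves the slack
   [f1 * eta * k * (k - 1) / 2], nonnegative because [k] is an integer. *)
have k_ge0 : 0 <= k%:R * (k%:R - 1) :> R.
  case: k {le_B le_B'} => [|k]; first by rewrite mul0r.
  by rewrite -natr1 addrK mulr_ge0 // addr_ge0.
have := mulr_ge0 (ltW eta_gt0) B_ge0.
have := mulr_ge0 (mulr_ge0 (ltW f1_gt0) (ltW eta_gt0)) k_ge0.
set x := k%:R in le_B le_B' k_ge0 *; lra.
Qed.

(* Several recharges in a row are split into single ones, all of amount 0 but
   the last, which makes the hypothesis of [funds_bounded_next] only weaker. *)
Lemma funds_bounded_jump k j B B' :
  0 <= B <= B' -> (j = 0%N -> B' = B) -> funds_bounded k B ->
  (j != 0%N -> (k + j)%:R * f1 + B' <= (2 - eta) * (f1 + B)) ->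
  funds_bounded (k + j) B'.
Proof.
case/andP=> B_ge0 le_BB'.
case: j => [/(_ erefl) -> |j _ bounded_k /(_ isT) le_B']; first by rewrite addn0.
rewrite addnS in le_B' *; apply: (funds_bounded_next B_ge0 _ le_B').
have {le_B'} : (k + j).+1%:R * f1 + B <= (2 - eta) * (f1 + B) by lra.
elim: j => [|j IH]; first by rewrite addn0.
rewrite addnS => le_B.
have {}le_B : (k + j).+1%:R * f1 + B <= (2 - eta) * (f1 + B).
  by apply: le_trans le_B; rewrite lerD2r ler_pM2r // ler_nat.
exact: funds_bounded_next B_ge0 (IH le_B) le_B.
Qed.

(** Since [B] is nonnegative, the quadratic term cannot outweigh the linear one, so [k <= 2 / eta];
    the bound is also at most [f1 * k]. *)
Lemma funds_bounded_const k B : 0 <= B -> funds_bounded k B -> B <= f1 * (2 / eta).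
Proof.
rewrite /funds_bounded => B_ge0 le_B.
have k_ge0 := ler0n R k; set x := k%:R in le_B k_ge0.
have x_le : x <= 2 / eta.
  rewrite ler_pdivlMr // leNgt; apply/negP => x_gt.
  have x_gt0 : 0 < x.
    by rewrite lt_def k_ge0 andbT; apply/eqP => x0; move: x_gt; rewrite x0; lra.
  have : 0 <= f1 * (x - eta * (x * (x + 1)) / 2) by exact: le_trans le_B.
  rewrite pmulr_rge0 // => ge0.
  by have := mulr_gt0 eta_gt0 x_gt0; nra.
apply: le_trans le_B _; rewrite ler_pM2l //.
have : 0 <= eta * (x * (x + 1)) by rewrite !mulr_ge0 ?addr_ge0 // ltW.
by lra.
Qed.

End RechargeBound.

(** * The stream of tiny equal transactions *)

Theorem corollary1 (R : realType) (r f1 f2 : R)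
    (r_gt0 : 0 < r) (f1_gt0 : 0 < f1) (f2_gt0 : 0 < f2)
    (c : R) (c_lt2 : c < 2) :
  ~ exists on : seq R -> seq (action R),
      online_algorithm on /\ competitive r f1 f2 c on.
Proof.
case=> on [on_ok on_comp].
pose c1 := Num.max c 1.
have c_le : c <= c1 by rewrite le_max lexx.
have c1_ge1 : 1 <= c1 by rewrite le_max lexx orbT.
have c1_ge0 : 0 <= c1 by lra.
have c1_lt2 : c1 < 2 by rewrite gt_max c_lt2 ltr1n.
(* Half of the gap below 2 is kept as [eta]; the other half absorbs the errors due to rejections and
   to the size [e]. *)
pose eta := (2 - c1) / 2.
have eta_gt0 : 0 < eta by rewrite /eta; lra.
have c1E : c1 = 2 - 2 * eta by rewrite /eta; field.
(* Chosen so that [2 * u + 4 * v = eta] for [u = e / f1] and [v = e / f2]. As [c1] and [2 - eta] are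
   at most 2, this yields [le1] below. *)
pose e := eta / (2 / f1 + 4 / f2).
have den_gt0 : 0 < 2 / f1 + 4 / f2 by rewrite addr_gt0 ?divr_gt0.
have e_gt0 : 0 < e by rewrite divr_gt0.
pose u := e / f1; pose v := e / f2.
have u_gt0 : 0 < u by rewrite divr_gt0.
have v_gt0 : 0 < v by rewrite divr_gt0.
have uE : e = u * f1 by rewrite /u divfK // gt_eqF.
have vE : e = v * f2 by rewrite /v divfK // gt_eqF.
have uvE : 2 * u + 4 * v = eta.
  have -> : eta = e * (2 / f1 + 4 / f2) by rewrite divfK // gt_eqF.
  by rewrite /u /v; ring.
clearbody u v e eta c1.
pose X n := nseq n e; pose s n := run on (X n).
have X_gt0 n : transactions (X n) by rewrite /transactions all_nseq e_gt0 orbT.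
have s_ok n : feasible 0 (X n) (s n) by exact: on_ok.
have s_cat n : s n.+1 = s n ++ on (X n.+1) by exact: run_nseqS.
pose k n := size (recharges (s n)); pose B n := funds (s n).
pose A n := f1 + n%:R * e.
have re_ge0 : 0 <= r * e by rewrite mulr_ge0 ?ltW.
have B_ge0 n : 0 <= B n by apply/funds_ge0/feasible_recharges_ge0/s_ok.
(* Competitiveness concerns nonempty streams, hence the index [n.+1]. The proportional rejection
   cost is dropped. *)
have s_cost n : (k n.+1)%:R * f1 + B n.+1 + (rejections (s n.+1))%:R * f2 <= c1 * A n.+1.
  have off_ge0 : 0 <= off_cost r f1 f2 (X n.+1) by apply: off_cost_ge0; rewrite ?ltW.
  have off_le : off_cost r f1 f2 (X n.+1) <= A n.+1 by apply: off_cost_nseq_le; rewrite ?ltW.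
  have := on_comp _ (X_gt0 n.+1) isT; rewrite -/(s _) (cost_nseq _ _ _ (s_ok _)).
  have := ler_wpM2r off_ge0 c_le.
  have := ler_wpM2l c1_ge0 off_le.
  have := mulr_ge0 (ler0n R (rejections (s n.+1))) re_ge0.
  rewrite /k /B; lra.
have A_ge n : f1 <= A n by rewrite /A lerDl mulr_ge0 ?ler0n ?ltW.
(* A rejection costs at least [f2], which is [e / v], so the rejected volume is at most [c1 * v]
   times the offline bound. *)
have A_le n : A n.+1 * (1 - c1 * v) <= f1 + B n.+1.
  have := feasible_size_le (lexx 0) (ltW e_gt0) (s_ok n.+1).
  rewrite -/(B _) add0r => size_le.
  have rej_le : (rejections (s n.+1))%:R * f2 <= c1 * A n.+1.
    apply: le_trans (s_cost n).
    by rewrite lerDr addr_ge0 ?mulr_ge0 // ltW.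
  have := ler_wpM2l (ltW v_gt0) rej_le.
  have -> : v * ((rejections (s n.+1))%:R * f2) = (rejections (s n.+1))%:R * e.
    by rewrite [in RHS]vE; ring.
  by rewrite /A; lra.
(* One more arrival adds [e = u * f1 <= u * a] to the offline bound, so the cost after it is
   controlled by the funds [b] held before it. *)
have grow (a b : R) : f1 <= a -> a * (1 - c1 * v) <= f1 + b ->
    c1 * (a + e) <= (2 - eta) * (f1 + b).
  move=> a_ge a_le.
  have le1 : c1 * (1 + u) <= (2 - eta) * (1 - c1 * v) by nra.
  have le2 : c1 * (a + e) <= a * (c1 * (1 + u)).
    by rewrite uE; have := ler_wpM2l (ltW u_gt0) a_ge; nra.
  apply: le_trans le2 _.
  have a_ge0 : 0 <= a by lra.
  have := ler_wpM2l a_ge0 le1.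
  have eta2 : 0 <= 2 - eta by lra.
  have := ler_wpM2l eta2 a_le; lra.
have bounded n : funds_bounded f1 eta (k n.+1) (B n.+1).
  elim: n => [|n IH].
    (* Starting from no recharges and no funds covers the actions both before and upon the first
       arrival. *)
    rewrite -(add0n (k 1%N)); apply: (@funds_bounded_jump _ _ _ _ _ 0%N _ 0) => //.
    - by rewrite lexx B_ge0.
    - exact: funds_no_recharge.
    - by rewrite /funds_bounded !mul0r mulr0 mul0r subr0 mulr0.
    - move=> _; rewrite add0n.
      have A1E : A 1%N = f1 + e by rewrite /A mul1r.
      have c1v_ge0 : 0 <= f1 * (c1 * v) by rewrite !mulr_ge0 // ltW.
      have f1_le : f1 * (1 - c1 * v) <= f1 + 0 by lra.
      apply: le_trans (grow _ _ (lexx _) f1_le); rewrite -A1E.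
      by apply: le_trans (s_cost 0%N); rewrite lerDl mulr_ge0 ?ler0n // ltW.
  have kE : k n.+2 = (k n.+1 + size (recharges (on (X n.+2))))%N.
    by rewrite /k s_cat /recharges pmap_cat size_cat.
  have BE : B n.+2 = B n.+1 + funds (on (X n.+2)) by rewrite /B s_cat funds_cat.
  have on_ge0 : 0 <= funds (on (X n.+2)).
    apply: funds_ge0; have := feasible_recharges_ge0 (s_ok n.+2).
    by rewrite s_cat /recharges pmap_cat all_cat => /andP[].
  rewrite kE; apply: funds_bounded_jump IH _ => //.
  - by rewrite B_ge0 BE lerDl.
  - by move=> /funds_no_recharge on0; rewrite BE on0 addr0.
  - move=> _; rewrite -kE; apply: le_trans (grow _ _ (A_ge n.+1) (A_le n)).
    have -> : A n.+1 + e = A n.+2 by rewrite /A -(natr1 n.+1); ring.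
    by apply: le_trans (s_cost n.+1); rewrite lerDl mulr_ge0 // ltW.
(* More than [M] transactions have a total size above twice the sum of [f1] and the uniform bound on
   the funds, which [A_le] excludes because [c1 * v <= 1 / 2]. *)
pose M := (f1 + f1 * (2 / eta)) * 2 / e.
have M_ge0 : 0 <= M.
  by rewrite ltW // !(divr_gt0, mulr_gt0, addr_gt0).
have := archi_boundP M_ge0; set n := Num.bound M => M_lt.
have n_gt : M < n.+1%:R by apply: lt_trans M_lt _; rewrite ltr_nat.
have := funds_bounded_const f1_gt0 eta_gt0 (B_ge0 _) (bounded n).
have := A_le n; move: n_gt; rewrite /M ltr_pdivrMr // => n_gt.
have half : A n.+1 * (1 / 2) <= A n.+1 * (1 - c1 * v).
  by rewrite ler_wpM2l //; [apply: le_trans (A_ge _); rewrite ltW | nra].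
by rewrite /A in half *; lra.
Qed.
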